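(* Consider general-type companies with agency-cost function $\rho(\cdot)$, threshold $\bar s(c)=\frac{c-\rho(c)}{1-\rho(c)}$ and liquidity index $ILL_{s_0}(c,\lambda)$ as defined in the context. Let $0\le\lambda_1<\lambda_2$ and set $$\Delta_\lambda ILL_{s_0}(c)=ILL_{s_0}(c,\lambda_2)-ILL_{s_0}(c,\lambda_1).$$ Let two companies have governance parameters $0<c^g<c^b<1$, all other parameters being the same. Then for every $s_0\ge0$ with $s_0<\bar s(c^g)$ and $s_0<\bar s(c^b)$, $$\Delta_\lambda ILL_{s_0}(c^g)>\Delta_\lambda ILL_{s_0}(c^b).$$
   Context: Fixed data: a real $\bar V>0$ (value of a share without agency cost), integers $N_I\ge0$ (number of informed traders) and $M\ge1$ (number of deals) with $M\ge N_I$, and $\Delta T>0$. Agency cost (general-type company): $\theta\in(0,1)$ and $f:(0,1)\to(0,\infty)$ is twice differentiable with $f'>0$ and $f''<0$. The agency cost of a company with governance parameter $c\in(0,1)$ (smaller $c$ means better governance) is $\rho(c)=\frac{1-\theta}{2}f(c)$, and it is assumed that $0\le\rho(c)\le c$ for all $c\in(0,1)$. Market model for given $c\in(0,1)$ and $\lambda\ge0$ (degree of noise traders' participation): write $\rho=\rho(c)$, $V(\rho)=(1-\rho)\bar V$ (fair value of a share) and $\underline V=(1-c)\bar V$. The number $N_U$ of participating noise traders is Poisson distributed with parameter $\lambda\Delta T$ ($N_U=0$ a.s. if $\lambda=0$). Each noise trader has an estimate of the share value; the estimates are i.i.d. uniform on $[\underline V,\bar V]$ and independent of $N_U$. Each of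 the $N_I$ informed traders has estimate $V(\rho)$. Let $N=N_I+N_U$ and let $\hat V^{(1)}\ge\dots\ge\hat V^{(N)}$ be all $N$ estimates in descending order. The market price after the $M$ deals is $$P_{T_2}=\hat V^{(M+1)}\ \text{ if } N>M,\qquad P_{T_2}=\underline V\ \text{ if } N\le M.$$ Let $\bar s(c)=\frac{c-\rho(c)}{1-\rho(c)}$. For $s_0\in[0,1)$ let $F_{s_0}(c,\lambda)=\Pr[P_{T_2}<(1-s_0)V(\rho)]$, and let $ILL_{s_0}(c,\lambda)=-\ln F_{s_0}(c,\lambda)$ if $F_{s_0}(c,\lambda)>0$ and $ILL_{s_0}(c,\lambda)=+\infty$ if $F_{s_0}(c,\lambda)=0$. For $s_0<\bar s(c)$ the index is finite. A larger $ILL_{s_0}$ means higher liquidity. *)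

(* Defs.v *)
From HB Require Import structures.
From mathcomp Require Import all_boot all_order all_algebra finmap.
From mathcomp Require Import all_classical all_reals all_analysis.

Set Implicit Arguments.
Unset Strict Implicit.
Unset Printing Implicit Defensive.

Import Order.TTheory GRing.Theory Num.Theory.
Import numFieldNormedType.Exports.

Local Open Scope classical_set_scope.
Local Open Scope ring_scope.

Section Company.
Context {R : realType}.
Implicit Types (theta Vbar c rho_c : R) (f rho : R -> R).

(* [f] is total on [R]; only its values on the open unit interval matter. *)
Definition smooth_increasing_concave f : Prop :=
  forall c, 0 < c < 1 ->
    [/\ 0 < f c, derivable f c 1, derivable (derive1 f) c 1,
        0 < derive1 f c & derive1 (derive1 f) c < 0].

Definition agency_cost theta f c : R := (1 - theta) / 2 * f c.

Definition fair_value Vbar rho_c : R := (1 - rho_c) * Vbar.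

Definition lowest_value Vbar c : R := (1 - c) * Vbar.

Definition threshold rho c : R := (c - rho c) / (1 - rho c).

End Company.

(* Mutual independence of a family of classes of events: the product rule holds
   for every finite subfamily. *)
Definition mutually_independent d (T : measurableType d) (R : realType)
    (P : probability T R) (I : choiceType) (G : I -> set (set T)) : Prop :=
  forall (J : {fset I}) (E : I -> set T),
    (forall i, i \in J -> G i (E i)) ->
    P (\bigcap_(i in [set` J]) E i) = (\prod_(i <- J) P (E i))%E.

(* [noise_estimate i] is defined for every [i : nat], but only the traders
   [i < noise_count] take part in the market. *)
Record noise_market (R : realType) := NoiseMarket {
  noise_display : measure_display ;
  noise_space : measurableType noise_display ;
  noise_prob : probability noise_space R ;
  noise_count : {RV noise_prob >-> nat} ;
  noise_estimate : nat -> {RV noise_prob >-> R}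
}.

Section Market.
Context {R : realType}.
Implicit Types (Vbar dT c lam : R) (rho : R -> R) (NI M : nat).
Implicit Types (m : noise_market R) (mkt : R -> R -> noise_market R).

(* Index [None] stands for the number of noise traders, [Some i] for the
   estimate of the [i]-th one. *)
Definition noise_events m (o : option nat) : set (set (noise_space m)) :=
  if o is Some i then g_sigma_algebra_preimage (noise_estimate m i)
  else g_sigma_algebra_preimage (noise_count m).

(* The second argument of [poisson_prob] is unused, and [poisson_prob 0 _] is
   the Dirac measure at 0. *)
Definition noise_market_law Vbar dT c lam m : Prop :=
  [/\ forall A : set nat,
        noise_prob m (noise_count m @^-1` A) = poisson_prob (lam * dT) 0 A,
      exists lt_values : lowest_value Vbar c < Vbar,
        forall (i : nat) (B : set R), measurable B ->
          noise_prob m (noise_estimate m i @^-1` B)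
          = uniform_prob lt_values B
    & mutually_independent (noise_prob m) (noise_events (m := m))].

Definition estimates NI (fair : R) m (w : noise_space m) : seq R :=
  nseq NI fair ++ mkseq (fun i => noise_estimate m i w) (noise_count m w).

(* [nth] counts from 0, so entry [M] is the (M+1)-th highest estimate. *)
Definition market_price NI M (fair lowest : R) m (w : noise_space m) : R :=
  let s := estimates NI fair w in
  if (M < size s)%N then nth lowest (sort >=%R s) M else lowest.

Definition drop_prob Vbar NI M rho mkt (s0 : R) c lam : R :=
  let fair := fair_value Vbar (rho c) in
  fine (noise_prob (mkt c lam)
    [set w | market_price NI M fair (lowest_value Vbar c) w < (1 - s0) * fair]).

Definition ILL Vbar NI M rho mkt (s0 : R) c lam : \bar R :=
  let F := drop_prob Vbar NI M rho mkt s0 c lam in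
  if 0 < F then (- ln F)%:E else +oo%E.

Definition delta_ILL Vbar NI M rho mkt (s0 lam1 lam2 : R) c : \bar R :=
  (ILL Vbar NI M rho mkt s0 c lam2 - ILL Vbar NI M rho mkt s0 c lam1)%E.

End Market.

(* Main.v *)
(* Given [N] noise traders, the price falls below [x = (1 - s0) V(rho)] exactly
   when at most [K = M - NI] noise estimates reach [x], because all informed
   estimates do. By Poisson thinning the number of noise estimates reaching [x]
   is Poisson of mean [lam dT p], with [p = (1 - (1 - s0)(1 - rho(c))) / c], so
   that [ILL = H (lam dT p)] with [H u = u - ln (\sum_(k <= K) u^k / k!)].
   Since [H' u = (u^K / K!) / \sum_(k <= K) u^k / k!] is nonnegative and
   nondecreasing, [p |-> H (b p) - H (a p)] is increasing for [0 <= a < b].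
   Finally [p] decreases with [c], because [rho] is positive and concave, which
   makes [rho(c) / c] decrease. *)
Require Import Defs.
From HB Require Import structures.
From mathcomp Require Import all_boot all_order all_algebra.
From mathcomp Require Import finmap.
From mathcomp Require Import all_classical all_reals all_analysis.
From mathcomp Require Import ring lra.

Set Implicit Arguments.
Unset Strict Implicit.
Unset Printing Implicit Defensive.

Import Order.TTheory GRing.Theory Num.Theory.
Import numFieldNormedType.Exports.

Local Open Scope classical_set_scope.
Local Open Scope ring_scope.

(** * Truncated exponential series and the Poisson distribution function *)

Section TruncatedExponential.
Context {R : realType}.
Implicit Types (n K : nat) (a b p q u x y : R).

(** The index counts the terms, all of degree below [n], so that differentiation lowers it by
    one. *)
Definition exp_trunc n x : R := \sum_(k < n) x ^+ k / k`!%:R.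

Lemma exp_truncS n x : exp_trunc n.+1 x = exp_trunc n x + x ^+ n / n`!%:R.
Proof. by rewrite /exp_trunc big_ord_recr. Qed.

Lemma exp_trunc_gt0 n x : 0 <= x -> 0 < exp_trunc n.+1 x.
Proof.
move=> x0; rewrite /exp_trunc big_ord_recl fact0 expr0 divr1 ltr_wpDr//.
by apply: sumr_ge0 => i _; rewrite divr_ge0 ?exprn_ge0.
Qed.

Lemma is_derive_exp_trunc n x :
  is_derive x 1 (exp_trunc n.+1) (exp_trunc n x).
Proof.
elim: n => [|n IH].
  have -> : exp_trunc 1 = cst 1.
    by apply/funext => y; rewrite /exp_trunc big_ord1 fact0 expr0 divr1.
  by rewrite /exp_trunc big_ord0; exact: is_derive_cst.
have -> : exp_trunc n.+2 = exp_trunc n.+1 + (n.+1)`!%:R^-1 *: (@id R) ^+ n.+1.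
  by apply/funext => y; rewrite exp_truncS fctE/= /GRing.scale/= exprfctE mulrC.
rewrite exp_truncS; apply: is_derive_eq.
rewrite /GRing.scale/= mulr1 factS natrM invfM; congr (_ + _).
field.
by rewrite pnatr_eq0 -lt0n fact_gt0 nat1r pnatr_eq0.
Qed.

(** Termwise, once [x ^+ k * y ^+ k] is factored out, this is [x ^+ (K - k) <= y ^+ (K - k)]. It
    makes the derivative of [neg_log_cdf K] nondecreasing. *)
Lemma exp_trunc_ratio_le K x y : 0 <= x -> x <= y ->
  x ^+ K * exp_trunc K.+1 y <= y ^+ K * exp_trunc K.+1 x.
Proof.
move=> x0 xy; have y0 := le_trans x0 xy.
rewrite /exp_trunc !mulr_sumr ler_sum// => k _.
rewrite !mulrA ler_wpM2r ?invr_ge0//.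
have kK : (k <= K)%N by rewrite -ltnS.
have XK z : z ^+ K = z ^+ (K - k) * z ^+ k by rewrite -exprD subnK.
rewrite !XK -!mulrA [y ^+ k * _]mulrC ler_wpM2r ?mulr_ge0 ?exprn_ge0//.
by rewrite lerXn2r// nnegrE.
Qed.

(* For a Poisson variable of mean [x], [neg_log_cdf K x] is
   [- ln (Pr [at most K])]. *)
Definition neg_log_cdf K x : R := x - ln (exp_trunc K.+1 x).

(** In [1 - exp_trunc K x / exp_trunc K.+1 x] only the top term of the denominator survives in the
    numerator. *)
Lemma is_derive_neg_log_cdf K x : 0 <= x ->
  is_derive x 1 (neg_log_cdf K) (x ^+ K / K`!%:R / exp_trunc K.+1 x).
Proof.
move=> x0; have T0 := exp_trunc_gt0 K x0.
have dT := is_derive_exp_trunc K x.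
have dln := is_derive1_ln T0.
have := @is_derive1_comp _ (@ln R) (exp_trunc K.+1) x _ _ dln dT => dc.
apply: is_derive_eq.
rewrite exp_truncS in T0 *.
have fK : K`!%:R != 0 :> R by rewrite pnatr_eq0 -lt0n fact_gt0.
rewrite /GRing.scale/=; field.
by rewrite fK/= -[x ^+ K](divfK fK) -mulrDl mulf_neq0// gt_eqF.
Qed.

Lemma neg_log_cdf_incr K a b p q : 0 <= a -> a < b -> 0 < p -> p < q ->
  neg_log_cdf K (b * p) - neg_log_cdf K (a * p) <
  neg_log_cdf K (b * q) - neg_log_cdf K (a * q).
Proof.
move=> a0 ab p0 pq; have b0 := le_lt_trans a0 ab.
pose g u := neg_log_cdf K (b * u) - neg_log_cdf K (a * u).
pose h u := u ^+ K / K`!%:R / exp_trunc K.+1 u.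
have dg u : 0 < u -> is_derive u 1 g (b * h (b * u) - a * h (a * u)).
  move=> u0.
  have comp d : 0 <= d -> is_derive u 1 (fun v => neg_log_cdf K (d * v)) (d * h (d * u)).
    move=> d0.
    have d1 : is_derive u 1 (d *: @id R) d.
      by apply: is_derive_eq; rewrite /GRing.scale/= mulr1.
    have d2 := is_derive_neg_log_cdf K (mulr_ge0 d0 (ltW u0)).
    have := @is_derive1_comp _ (neg_log_cdf K) (d *: @id R) u _ _ d2 d1.
    by rewrite mulrC.
  have c1 := comp b (ltW b0); have c2 := comp a a0.
  exact: is_deriveB.
have h_le x y : 0 <= x -> x <= y -> h x <= h y.
  move=> x0 xy; have y0 := le_trans x0 xy.
  rewrite /h ler_pdivrMr ?exp_trunc_gt0// mulrAC ler_pdivlMr ?exp_trunc_gt0//.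
  rewrite mulrAC [leRHS]mulrAC ler_wpM2r ?invr_ge0//.
  exact: exp_trunc_ratio_le.
have g'_gt0 u : 0 < u -> 0 < b * h (b * u) - a * h (a * u).
  move=> u0; have hb : 0 < h (b * u).
    rewrite /h divr_gt0 ?exp_trunc_gt0 ?mulr_ge0 ?(ltW b0) ?(ltW u0)//.
    by rewrite divr_gt0 ?exprn_gt0 ?mulr_gt0 ?ltr0n ?fact_gt0.
  (* The chain is [a * h (a * u) <= a * h (b * u) < b * h (b * u)], strict because [h (b * u)] is
     positive. *)
  rewrite subr_gt0 (@le_lt_trans _ _ (a * h (b * u)))//; last by rewrite ltr_pM2r.
  by rewrite ler_wpM2l// h_le ?mulr_ge0 ?(ltW u0)// ler_pM2r// ltW.
have pos u : u \in `[p, q] -> 0 < u.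
  by rewrite in_itv/= => /andP[pu _]; exact: lt_le_trans pu.
apply: (@gtr0_derive1_lt_cc _ g p q _ _ _ p q) => //.
- by move=> u /subset_itv_oo_cc/pos/dg[].
- move=> u /subset_itv_oo_cc/pos u0.
  by rewrite derive1E; have [_ ->] := dg _ u0; exact: g'_gt0.
- by apply: derivable_within_continuous => u /pos/dg[].
- by rewrite in_itv/= lexx ltW.
- by rewrite in_itv/= lexx ltW.
Qed.

End TruncatedExponential.

(** * Chords and ratios of a positive concave function *)

Section SmoothIncreasingConcave.
Context {R : realType}.
Context (f : R -> R) (hf : smooth_increasing_concave f).

Lemma concave_derive1_decr a b : 0 < a -> a < b -> b < 1 -> f^`()%classic b < f^`()%classic a.
Proof.
move=> a0 ab b1.
have in01 x : x \in `[a, b] -> 0 < x < 1.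
  rewrite in_itv/= => /andP[ax xb].
  by rewrite (lt_le_trans a0 ax) (le_lt_trans xb b1).
apply: (@ltr0_derive1_lt_cc _ (f^`()%classic) a b _ _ _ b a) => //.
- by move=> x /subset_itv_oo_cc/in01/hf[].
- by move=> x /subset_itv_oo_cc/in01/hf[].
- by apply: derivable_within_continuous => x /in01/hf[].
- by rewrite in_itv/= lexx ltW.
- by rewrite in_itv/= lexx ltW.
Qed.

(** By the mean value theorem the slope of the chord is [f'] at an interior point, and [f'] strictly
    decreases. *)
Lemma concave_chord_bounds a b : 0 < a -> a < b -> b < 1 ->
  f^`()%classic b * (b - a) < f b - f a < f^`()%classic a * (b - a).
Proof.
move=> a0 ab b1.
have in01 x : x \in `[a, b] -> 0 < x < 1.
  rewrite in_itv/= => /andP[ax xb].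
  by rewrite (lt_le_trans a0 ax) (le_lt_trans xb b1).
have df x : x \in `]a, b[ -> is_derive x 1 f (f^`()%classic x).
  move=> /subset_itv_oo_cc/in01/hf[_ dfx _ _ _].
  by rewrite derive1E; exact/derivableP.
have cf : {within `[a, b], continuous f}.
  by apply: derivable_within_continuous => x /in01/hf[].
have [c + ->] := MVT ab df cf.
rewrite in_itv/= => /andP[ac cb].
rewrite !ltr_pM2r ?subr_gt0// !concave_derive1_decr//.
- exact: lt_trans cb b1.
- exact: lt_trans a0 ac.
Qed.

(** Positivity of [f] to the left of [a] forces [a * f' a <= f a]; the chord bound
    [f b < f a + f' a * (b - a)] then gives [a * f b < b * f a]. *)
Lemma concave_ratio_decr a b : 0 < a -> a < b -> b < 1 -> f b / b < f a / a.
Proof.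
move=> a0 ab b1; have b0 := lt_trans a0 ab; have a1 := lt_trans ab b1.
have [|fa_gt0 _ _ f'a_gt0 _] := hf (c := a); first by rewrite a0.
have tangent : f^`()%classic a * a <= f a.
  rewrite leNgt; apply/negP => lt_fa.
  (* [e] is where the tangent at [a] crosses zero. *)
  pose e := a - f a / f^`()%classic a.
  have e0 : 0 < e by rewrite subr_gt0 ltr_pdivrMr// mulrC.
  have ea : e < a by rewrite ltrBlDr ltrDl divr_gt0.
  have [|fe_gt0 _ _ _ _] := hf (c := e); first by rewrite e0 (lt_trans ea).
  (* Here [f' a * (a - e) = f a], so the lower chord bound yields [f e < 0]. *)
  have /andP[+ _] := concave_chord_bounds e0 ea a1.
  rewrite /e opprB addrC subrK mulrC divfK ?gt_eqF// -/e; lra.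
have /andP[_ fb] := concave_chord_bounds a0 ab b1.
rewrite ltr_pdivrMr// mulrAC ltr_pdivlMr//.
nra.
Qed.

End SmoothIncreasingConcave.

(** * Order statistics and the market price *)

Section OrderStatistic.
Context {R : realType}.
Implicit Types (x lowest fair : R) (s : seq R) (M NI : nat).

(** In descending order the entries reaching [x] come first, and the entry at index [M] has exactly
    [M] predecessors. On lists of size at most [M] both sides hold, as [lowest < x]. *)
Lemma nth_sort_ge_lt x lowest s M : lowest < x ->
  ((if (M < size s)%N then nth lowest (sort >=%R s) M else lowest) < x) =
  (count (>= x) s <= M)%N.
Proof.
move=> low_x; case: ifPn => [Ms|]; last first.
  by rewrite -leqNgt low_x => sM; rewrite (leq_trans (count_size _ _)).
have srt : sorted >=%R (sort >=%R s) by apply: sort_sorted => y z; exact: le_total.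
have tr : transitive (>=%R : rel R) by move=> a b c ab bc; exact: le_trans bc ab.
have <- : count (>= x) (sort >=%R s) = count (>= x) s.
  by apply/permP; rewrite perm_sort.
move: Ms; rewrite -(size_sort >=%R s); move: (sort _ _) srt => {s} t srt Mt.
have nth_ge i j : (i <= j < size t)%N -> nth lowest t j <= nth lowest t i.
  move=> /andP[ij jt].
  by apply: (sorted_leq_nth tr lexx); rewrite // inE (leq_ltn_trans ij).
apply/idP/idP => [lt_x|].
(* All entries from index [M] on are below [x], so only the first [M] can reach it. *)
- rewrite -(cat_take_drop M t) count_cat.
  suff -> : count (>= x) (drop M t) = 0%N.
    by rewrite addn0 (leq_trans (count_size _ _))// size_take Mt.
  apply/eqP; rewrite eqn0Ngt -has_count; apply/hasPn => y /(nthP lowest)[i].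
  rewrite size_drop nth_drop => iM <-; rewrite -ltNge (le_lt_trans _ lt_x)//.
  by rewrite nth_ge// leq_addr/= -ltn_subRL.
(* If entry [M] reaches [x], so do all [M.+1] entries up to it. *)
- apply: contraTT; rewrite -leNgt -ltnNge => x_le.
  rewrite -(cat_take_drop M.+1 t) count_cat ltn_addr//.
  suff : all (>= x) (take M.+1 t).
    by rewrite all_count => /eqP ->; rewrite size_takel.
  apply/(all_nthP lowest) => i; rewrite size_takel// => iM.
  by rewrite nth_take// (le_trans x_le)// nth_ge// -ltnS iM Mt.
Qed.

(** The informed estimates all equal [fair >= x] and use up [NI] of the [M] admissible places;
    [NI <= M] makes the truncated subtraction exact. *)
Lemma market_price_lt NI M fair lowest x (m : noise_market R) w :
    lowest < x -> x <= fair -> (NI <= M)%N ->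
  (market_price NI M fair lowest w < x) =
  (count (>= x) (mkseq (fun i => noise_estimate m i w) (noise_count m w))
    <= M - NI)%N.
Proof.
move=> low_x x_fair NIM; rewrite /market_price nth_sort_ge_lt// /estimates.
by rewrite count_cat count_nseq x_fair mul1n leq_subRL.
Qed.

End OrderStatistic.

(** * Poisson thinning as a power series identity *)

Section Thinning.
Context {R : realType}.
Implicit Types (p q mu x : R) (n K : nat).

(** Group the subsets by cardinality: ['C(n, k)] of them have [k] elements. *)
Lemma sum_binomial_prefix n K p q :
  \sum_(J : {set 'I_n} | (#|J| <= K)%N) p ^+ #|J| * q ^+ (n - #|J|) =
  \sum_(k < K.+1) p ^+ k * q ^+ (n - k) *+ 'C(n, k).
Proof.
(* [inord] is faithful here, since the sum only keeps [#|J| <= K]. *)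
rewrite (partition_big (fun J : {set 'I_n} => inord #|J| : 'I_K.+1) xpredT)//=.
apply: eq_bigr => k _.
rewrite (eq_bigl (fun J : {set 'I_n} => #|J| == k)) => [|J]; last first.
  apply/andP/eqP => [[JK /eqP <-]|Jk]; first by rewrite inordK.
  by split; [rewrite Jk -ltnS|rewrite Jk inord_val].
rewrite (eq_bigr (fun=> p ^+ k * q ^+ (n - k))) => [|J /eqP -> //].
rewrite sumr_const; congr (_ *+ _).
rewrite -[in RHS](card_ord n) -card_draws cardsE.
by apply: eq_card => J.
Qed.

Local Open Scope ereal_scope.

Lemma nneseries_expR x : (0 <= x)%R ->
  \sum_(n <oo) (x ^+ n / n`!%:R)%:E = (expR x)%:E.
Proof.
move=> x0; rewrite /expR -EFin_lim; last exact: is_cvg_series_exp_coeff.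
by apply/congr_lim/funext => n/=; rewrite /series/= -sumEFin.
Qed.

(** Terms with [n < k] vanish. After a shift of [n] by [k], the factorization
    [(n + k)! = 'C(n + k, k) * k! * n!] leaves the exponential series of [mu * q]. *)
Lemma nneseries_thinning_term mu p q k : (0 <= mu)%R -> (0 <= p)%R -> (0 <= q)%R ->
  \sum_(n <oo) (mu ^+ n / n`!%:R * (p ^+ k * q ^+ (n - k) *+ 'C(n, k)))%:E =
  ((mu * p) ^+ k / k`!%:R * expR (mu * q))%:E.
Proof.
move=> mu0 p0 q0.
have t0 n : (0 <= mu ^+ n / n`!%:R * (p ^+ k * q ^+ (n - k) *+ 'C(n, k)))%R.
  by rewrite mulr_ge0 ?divr_ge0 ?mulrn_wge0 ?mulr_ge0 ?exprn_ge0.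
rewrite (nneseries_split 0 k); last by move=> n _; rewrite lee_fin.
rewrite big_nat big1 ?add0e => [|n /andP[_ nk]]; last first.
  by rewrite bin_small// mulr0n mulr0.
rewrite -nneseries_addn; last by move=> n; rewrite lee_fin.
rewrite EFinM -nneseries_expR ?mulr_ge0// -nneseriesZl; last first.
  by move=> n _; rewrite lee_fin divr_ge0 ?exprn_ge0 ?mulr_ge0.
apply: eq_eseriesr => n _; rewrite -EFinM; congr EFin.
rewrite addnK -mulr_natr.
have fact_neq0 m : (m`!%:R != 0 :> R)%R by rewrite pnatr_eq0 -lt0n fact_gt0.
have -> : ((n + k)`!%:R = 'C(n + k, k)%:R * (k`!%:R * n`!%:R) :> R)%R.
  by rewrite -!natrM -[in LHS](bin_fact (leq_addl n k)) addnK.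
have C0 : ('C(n + k, k)%:R != 0 :> R)%R by rewrite pnatr_eq0 -lt0n bin_gt0 leq_addl.
rewrite exprD !exprMn; field.
by rewrite C0 !fact_neq0.
Qed.

(** Swapping the series with the finite sum over [k] produces a factor [expR (mu * (1 - p))], which
    combines with [expR (- mu)] into [expR (- (mu * p))]. *)
Lemma nneseries_thinning mu p K : (0 <= mu)%R -> (0 <= p <= 1)%R ->
  \sum_(n <oo) (mu ^+ n / n`!%:R * expR (- mu) *
    \sum_(k < K.+1) p ^+ k * (1 - p) ^+ (n - k) *+ 'C(n, k))%:E =
  (expR (- (mu * p)) * exp_trunc K.+1 (mu * p))%:E.
Proof.
move=> mu0 /andP[p0 p1]; have q0 : (0 <= 1 - p)%R by rewrite subr_ge0.
under eq_eseriesr => n _.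
  rewrite mulrAC EFinM muleC mulr_sumr -sumEFin; over.
have t0 k n : (0 <= mu ^+ n / n`!%:R * (p ^+ k * (1 - p) ^+ (n - k) *+ 'C(n, k)))%R.
  by rewrite mulr_ge0 ?divr_ge0 ?mulrn_wge0 ?mulr_ge0 ?exprn_ge0.
rewrite nneseriesZl; last by move=> n _; apply: sume_ge0 => k _; rewrite lee_fin.
rewrite nneseries_sum; last by move=> k n _; rewrite lee_fin.
under eq_bigr do rewrite nneseries_thinning_term//.
rewrite sumEFin -EFinM; congr EFin.
rewrite /exp_trunc -mulr_suml mulrC -mulrA mulrC -expRD; congr (expR _ * _)%R.
ring.
Qed.

End Thinning.

(** * Law of the number of noise estimates reaching a level *)

Section NoiseMarketLaw.
Context {R : realType}.
Implicit Types (m : noise_market R) (x q : R) (n K : nat).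

(** [J] prescribes exactly which of the [n] traders reach [x], so the event is a finite intersection
    of independent events, one for the count and one per trader. *)
Lemma prob_noise_pattern m x q n (J : {set 'I_n}) :
    mutually_independent (noise_prob m) (noise_events (m := m)) ->
    (forall i, noise_prob m (noise_estimate m i @^-1` [set r | x <= r]) = q%:E) ->
  noise_prob m [set w | noise_count m w = n /\
    [set i : 'I_n | x <= noise_estimate m i w]%SET = J] =
  (noise_prob m (noise_count m @^-1` [set n]) *
   (q ^+ #|J| * (1 - q) ^+ (n - #|J|))%:E)%E.
Proof.
move=> indep hq.
have mx : measurable [set r : R | x <= r].
  by rewrite -set_itvcy; exact: measurable_itv.
pose above i := noise_estimate m i @^-1` [set r | x <= r].
(* The events are indexed by [option nat], hence membership in [J] is restated for plain
   naturals. *)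
pose inJ k := [exists i : 'I_n, (i == k :> nat) && (i \in J)].
pose E o := if o is Some k then if inJ k then above k else ~` above k
            else noise_count m @^-1` [set n].
pose I := [fset o | o in None :: [seq Some (val i) | i : 'I_n]]%fset.
have inJE (i : 'I_n) : inJ i = (i \in J).
  apply/existsP/idP => [[j /andP[/eqP/val_inj -> //]]|iJ].
  by exists i; rewrite eqxx.
have II : perm_eq I (None :: [seq Some (val i) | i : 'I_n]).
  apply: uniq_perm; first exact: fset_uniq.
    rewrite /= map_inj_uniq ?enum_uniq ?andbT; last by move=> i j [/val_inj].
    by apply/negP => /mapP[].
  by move=> o; rewrite !inE.
have -> : [set w | noise_count m w = n /\
    [set i : 'I_n | x <= noise_estimate m i w]%SET = J] =
    \bigcap_(o in [set` I]) E o.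
  apply/seteqP; split=> [w [wn wJ] o/=|w wE].
    rewrite (perm_mem II) inE => /orP[/eqP -> //|/mapP[i _ ->]]/=.
    by rewrite inJE -wJ inE; case: ifPn => // /negP.
  split; first by apply: (wE None); rewrite /= (perm_mem II) inE.
  apply/setP => i; rewrite inE.
  have /= := wE (Some (val i)); rewrite (perm_mem II) inE/= map_f ?mem_enum//.
  rewrite inJE => /(_ isT); case: ifPn => [_ -> //|_ /negP/negbTE -> //].
rewrite indep; last first.
  move=> [k|] _ /=; last by exists [set n]; rewrite ?setTI.
  case: ifP => _; last exists (~` [set r | x <= r]).
  - by exists [set r | x <= r]; rewrite ?setTI.
  - exact: measurableC.
  - by rewrite setTI.
rewrite (perm_big _ II) big_cons big_map; congr (_ * _)%E.
rewrite (eq_bigr (fun i : 'I_n => (if i \in J then q else 1 - q)%:E)); last first.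
  move=> i _ /=; rewrite inJE; case: ifP => _; first exact: hq.
  rewrite probability_setC ?hq//.
  by rewrite -[above _]setTI; exact: measurable_funPT.
rewrite big_enum/= prodEFin; congr EFin.
rewrite (bigID (mem J))/=; congr (_ * _).
  by rewrite (eq_bigr (fun=> q)) ?prodr_const// => i ->.
rewrite (eq_bigr (fun=> 1 - q)) => [|i /negbTE -> //].
rewrite prodr_const; congr (_ ^+ _).
by apply: (canRL (addKn _)); rewrite cardC card_ord.
Qed.

(** For [mu = 0] the law is the Dirac mass at 0, and the formula persists because [0 ^+ 0 = 1]. *)
Lemma poisson_prob_set1 (mu : R) n k : 0 <= mu ->
  poisson_prob mu k [set n] = (mu ^+ n / n`!%:R * expR (- mu))%:E.
Proof.
rewrite le_eqVlt /poisson_prob => /predU1P[<-|mu0].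
  rewrite ltxx diracE oppr0 expR0 mulr1; case: n => [|n].
    by rewrite mem_set// expr0 fact0 divr1.
  by rewrite memNset// expr0n/= mul0r.
by rewrite mu0 esum_set1 ?lee_fin ?poisson_pmf_ge0// /poisson_pmf mu0.
Qed.

(** Split the event by the count [n] and the set [J] of traders reaching [x]: summing over
    [#|J| <= K] gives a binomial prefix, and summing over [n] is thinning. *)
Lemma prob_noise_count_le m (mu p x : R) K :
    (forall A, noise_prob m (noise_count m @^-1` A) = poisson_prob mu 0 A) ->
    mutually_independent (noise_prob m) (noise_events (m := m)) ->
    (forall i, noise_prob m (noise_estimate m i @^-1` [set r | x <= r]) = p%:E) ->
    0 <= mu -> 0 <= p <= 1 ->
  noise_prob m [set w | (count (>= x)
    (mkseq (fun i => noise_estimate m i w) (noise_count m w)) <= K)%N] =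
  (expR (- (mu * p)) * exp_trunc K.+1 (mu * p))%:E.
Proof.
move=> hcount indep hp mu0 p01.
pose above n w := [set i : 'I_n | x <= noise_estimate m i w]%SET.
pose F n (J : {set 'I_n}) := [set w | noise_count m w = n /\ above n w = J].
pose small n := enum [pred J : {set 'I_n} | (#|J| <= K)%N].
have card_above n w :
    count (>= x) (mkseq (fun i => noise_estimate m i w) n) = #|above n w|.
  rewrite /mkseq -val_enum_ord -map_comp count_map -sum1_count big_enum_cond.
  by rewrite -sum1_card; apply: eq_bigl => i; rewrite [RHS]inE.
have mN n : measurable (noise_count m @^-1` [set n]).
  by rewrite -[_ @^-1` _]setTI; exact: measurable_funPT.
have mX i : measurable [set w | x <= noise_estimate m i w].
  have mx : measurable [set r : R | x <= r].
    by rewrite -set_itvcy; exact: measurable_itv.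
  exact: (measurable_funPTI (noise_estimate m i) mx).
have mF n J : measurable (F n J).
  have -> : F n J = noise_count m @^-1` [set n] `&` \bigcap_(i in [set: 'I_n])
      (if i \in J then [set w | x <= noise_estimate m i w]
       else ~` [set w | x <= noise_estimate m i w]).
    apply/seteqP; split=> w /= [wn wJ]; split=> //.
      by move=> i _; rewrite -wJ inE; case: ifPn => // /negP.
    apply/setP => i; rewrite inE; have := wJ i Logic.I.
    by case: ifPn => [_ /= -> //|_ /negP/negbTE].
  apply: measurableI => //; apply: fin_bigcap_measurable; first exact: finite_finset.
  by move=> i _; case: ifP => _ //; exact: measurableC.
have -> : [set w | (count (>= x)
    (mkseq (fun i => noise_estimate m i w) (noise_count m w)) <= K)%N] =
    \bigcup_n \bigcup_(J in [set` small n]) F n J.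
  apply/seteqP; split=> [w wK|w [n _ [J]]].
    exists (noise_count m w) => //; exists (above (noise_count m w) w) => //=.
    by rewrite mem_enum inE -card_above.
  by rewrite /= mem_enum inE => JK [-> wJ]; rewrite card_above wJ.
have mbig n : measurable (\bigcup_(J in [set` small n]) F n J).
  by apply: fin_bigcup_measurable => //; exact: finite_seq.
rewrite measure_semi_bigcup//; last 2 first.
- apply/trivIsetP => i j _ _ ij; apply/seteqP; split => // w.
  by move=> [[J _ [wi _]] [J' _ [wj _]]]; move: ij; rewrite -wi -wj eqxx.
- exact: bigcupT_measurable.
rewrite -nneseries_thinning//; apply: eq_eseriesr => n _.
rewrite measure_fin_bigcup//; last first.
  apply/trivIsetP => J J' _ _ JJ'; apply/seteqP; split => // w.
    by move=> [[_ wJ] [_ wJ']]; move: JJ'; rewrite -wJ -wJ' eqxx.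
rewrite -fsbig_seq ?enum_uniq// big_enum_cond/=.
under eq_bigr => J _ do rewrite (prob_noise_pattern _ indep hp) hcount poisson_prob_set1//.
rewrite -sum_binomial_prefix mulr_sumr -sumEFin.
by apply: eq_big => [J|J _]; rewrite ?andbT// EFinM.
Qed.

End NoiseMarketLaw.

(** * Tail of the uniform law *)

Section UniformTail.
Context {R : realType}.

Lemma uniform_prob_ge (a b x : R) (ab : a < b) : a <= x -> x <= b ->
  uniform_prob ab [set r | x <= r] = ((b - x) / (b - a))%:E.
Proof.
move=> ax xb; rewrite /uniform_prob integral_uniform_pdf.
have -> : [set r | x <= r] `&` `[a, b] = `[x, b]%classic.
  apply/seteqP; split => r /=; rewrite !in_itv/=.
    by move=> [xr /andP[_ ->]]; rewrite xr.
  by move=> /andP[xr ->]; rewrite xr (le_trans ax).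
rewrite (eq_integral (cst ((b - a)^-1)%:E)); last first.
  move=> r; rewrite inE/= in_itv/= => /andP[xr rb].
  by rewrite /uniform_pdf (le_trans ax xr) rb.
rewrite integral_cst//= lebesgue_measure_itv/= lte_fin; case: ltP => [_|bx].
  by rewrite -EFinB -EFinM mulrC.
(* The remaining case is the one-point interval, of measure 0. *)
have -> : x = b by apply/eqP; rewrite eq_le xb.
by rewrite mule0 subrr mul0r.
Qed.

End UniformTail.

(** * Closed form of the liquidity index *)

Section Liquidity.
Context {R : realType}.
Implicit Types (Vbar dT c lam s : R) (rho : R -> R).

(* The probability that a noise trader's estimate reaches
   [(1 - s) * fair_value Vbar (rho c)]. *)
Definition reach_prob rho s c : R := (1 - (1 - s) * (1 - rho c)) / c.

(** In [s0 / c + (1 - s0) * (rho c / c)] the first term does not increase with [c], and the second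
    drops strictly because [s0 < 1]. *)
Lemma reach_prob_decr rho (s0 : R) c1 c2 : 0 <= s0 -> s0 < 1 -> 0 < c1 -> c1 < c2 ->
  rho c2 / c2 < rho c1 / c1 -> reach_prob rho s0 c2 < reach_prob rho s0 c1.
Proof.
move=> s0_ge0 s0_lt1 c1_gt0 c12 rho_lt; have c2_gt0 := lt_trans c1_gt0 c12.
have E c : reach_prob rho s0 c = s0 * c^-1 + (1 - s0) * (rho c / c).
  by rewrite /reach_prob; ring.
rewrite !E ler_ltD ?ltr_pM2l ?subr_gt0//.
by rewrite ler_wpM2l// lef_pV2 ?posrE// ltW.
Qed.

(** Below the threshold the drop probability is a positive Poisson distribution function, so [ILL]
    takes its finite branch and no [+oo] enters the differences. *)
Lemma ILL_eq Vbar NI M dT rho (mkt : R -> R -> noise_market R) (s0 : R) c lam :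
    0 < Vbar -> (NI <= M)%N -> 0 < dT -> 0 < c -> c < 1 -> 0 <= lam ->
    0 <= rho c <= c -> 0 <= s0 -> s0 < threshold rho c ->
    noise_market_law Vbar dT c lam (mkt c lam) ->
  ILL Vbar NI M rho mkt s0 c lam =
  (neg_log_cdf (M - NI) (lam * dT * reach_prob rho s0 c))%:E.
Proof.
move=> V0 NIM dT0 c0 c1 lam0 /andP[rho0 rhoc] s00.
have rho1 : 0 < 1 - rho c by lra.
rewrite /threshold ltr_pdivlMr// => s0lt [hcount [lowV hunif] indep].
have s01 : s0 < 1.
  by rewrite -(@ltr_pM2r _ (1 - rho c))// (lt_trans s0lt)//; lra.
set mu := lam * dT; set p := reach_prob rho s0 c.
have mu0 : 0 <= mu by rewrite mulr_ge0// ltW.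
(* Up to the factor [Vbar] this is [s0 * (1 - rho c) < c - rho c], the threshold hypothesis. *)
have low_x : lowest_value Vbar c < (1 - s0) * fair_value Vbar (rho c).
  by rewrite /lowest_value /fair_value mulrA ltr_pM2r//; nra.
have x_fair : (1 - s0) * fair_value Vbar (rho c) <= fair_value Vbar (rho c).
  by rewrite ger_pMl ?mulr_gt0//; lra.
have x_V : (1 - s0) * fair_value Vbar (rho c) <= Vbar.
  by rewrite (le_trans x_fair)// ger_pMl//; lra.
have mx : measurable [set r | (1 - s0) * fair_value Vbar (rho c) <= r].
  by rewrite -set_itvcy; exact: measurable_itv.
have hp i : noise_prob (mkt c lam) (noise_estimate (mkt c lam) i @^-1`
    [set r | (1 - s0) * fair_value Vbar (rho c) <= r]) = p%:E.
  rewrite hunif//.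
  rewrite uniform_prob_ge ?(ltW low_x)// /p /reach_prob /lowest_value /fair_value.
  by congr EFin; field; rewrite !gt_eqF//; nra.
have p01 : 0 <= p <= 1.
  by rewrite -!lee_fin -(hp 0%N) measure_ge0 probability_le1//; exact: (measurable_funPTI _ mx).
rewrite /ILL /drop_prob.
under eq_set => w do rewrite market_price_lt//.
rewrite (prob_noise_count_le _ hcount indep hp mu0 p01)/=.
have mup0 : 0 <= mu * p by rewrite mulr_ge0//; case/andP: p01.
have T0 := exp_trunc_gt0 (M - NI) mup0.
rewrite mulr_gt0 ?expR_gt0// lnM ?posrE ?expR_gt0// expRK.
by rewrite /neg_log_cdf opprD opprK.
Qed.

End Liquidity.

Theorem proposition4 (R : realType)
  (Vbar : R) (Vbar_gt0 : 0 < Vbar)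
  (NI M : nat) (M_ge1 : (1 <= M)%N) (NI_le_M : (NI <= M)%N)
  (dT : R) (dT_gt0 : 0 < dT)
  (theta : R) (theta01 : 0 < theta < 1)
  (f : R -> R) (hf : smooth_increasing_concave f)
  (hrho : forall c : R, 0 < c < 1 -> 0 <= agency_cost theta f c <= c)
  (mkt : R -> R -> noise_market R)
  (hmkt : forall c lam : R, 0 < c < 1 -> 0 <= lam ->
    noise_market_law Vbar dT c lam (mkt c lam))
  (lam1 lam2 : R) (lam1_ge0 : 0 <= lam1) (lam1_lt_lam2 : lam1 < lam2)
  (cg cb : R) (cg_gt0 : 0 < cg) (cg_lt_cb : cg < cb) (cb_lt1 : cb < 1)
  (s0 : R) (s0_ge0 : 0 <= s0)
  (s0_lt_g : s0 < threshold (agency_cost theta f) cg)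
  (s0_lt_b : s0 < threshold (agency_cost theta f) cb) :
  (delta_ILL Vbar NI M (agency_cost theta f) mkt s0 lam1 lam2 cg >
   delta_ILL Vbar NI M (agency_cost theta f) mkt s0 lam1 lam2 cb)%E.
Proof.
have cg_lt1 := lt_trans cg_lt_cb cb_lt1; have cb_gt0 := lt_trans cg_gt0 cg_lt_cb.
have lam2_gt0 := le_lt_trans lam1_ge0 lam1_lt_lam2; have lam2_ge0 := ltW lam2_gt0.
have cg01 : 0 < cg < 1 by rewrite cg_gt0.
have cb01 : 0 < cb < 1 by rewrite cb_gt0.
have /andP[theta_gt0 theta_lt1] := theta01.
rewrite /delta_ILL !(ILL_eq _ NI_le_M dT_gt0 _ _ _ (hrho _ _) s0_ge0 _ (hmkt _ _ _ _))//.
rewrite -!EFinB lte_fin -!mulrA.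
have /andP[rhob_ge0 rhob_le] := hrho cb cb01.
have s0_lt1 : s0 < 1.
  by rewrite (lt_le_trans s0_lt_b)// /threshold ler_pdivrMr; lra.
(* At [s0 = 0] the reach probability is [rho c / c], so its positivity rests on that of the agency
   cost. *)
have rhob_gt0 : 0 < agency_cost theta f cb.
  have [fb_gt0 _ _ _ _] := hf _ cb01.
  by rewrite /agency_cost mulr_gt0// divr_gt0// subr_gt0.
(* Here [a = lam1], [b = lam2], and the two points are [dT * reach_prob] at [cb] and at [cg]. *)
apply: neg_log_cdf_incr => //.
- rewrite mulr_gt0// /reach_prob divr_gt0//; nra.
- rewrite ltr_pM2l//; apply: reach_prob_decr => //.
  (* The factor [(1 - theta) / 2] cancels, leaving the ratios [f c / c]. *)
  rewrite /agency_cost -!mulrA ltr_pM2l ?subr_gt0// ltr_pM2l ?invr_gt0//.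
  exact: concave_ratio_decr.
Qed.
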